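(* For every integer $n\ge 18$ there exists a connected plane graph $G$ on $n$ vertices with maximum degree $\Delta(G)=4$ that has no facial $(P_3,P_3)$-WORM coloring.
   Context: All graphs are finite, planar, with a fixed plane embedding. A facial $k$-path (facial $P_k$) in a plane graph is a path on $k$ vertices whose vertices and edges appear consecutively on the boundary walk of some face. A set of vertices is rainbow under a vertex-coloring if its vertices receive pairwise distinct colors, and monochromatic if all its vertices receive the same color. A facial $(P_k,P_\ell)$-WORM coloring of a plane graph $G$ is a coloring of the vertices of $G$ (with any number of colors) such that $G$ contains no rainbow facial $P_k$ and no monochromatic facial $P_\ell$. *)

(* Defs.v *)
From mathcomp Require Import all_boot all_fingroup.

Set Implicit Arguments.
Unset Strict Implicit.
Unset Printing Implicit Defensive.

(** Embeddings are represented combinatorially: an embedding of a finite simple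
    graph in the plane (equivalently, in the sphere), up to orientation
    preserving homeomorphism of each component, is given by the clockwise
    cyclic order of the neighbours around every vertex, subject to Euler's
    formula. *)
Record embedded_graph := EmbeddedGraph {
  vertex :> finType;
  adj : rel vertex;
  adj_sym : symmetric adj;
  adj_irr : irreflexive adj;
  (* [rot v u] is the neighbour of [v] that follows [u] clockwise around [v];
     [rot v] is irrelevant outside the neighbourhood of [v]. *)
  rot : vertex -> {perm vertex};
  rot_cyclic : forall v u, adj v u -> porbit (rot v) u = [set w | adj v w]
}.

Section Graph.
Variable G : embedded_graph.

Definition degree (v : G) : nat := #|[set w | adj v w]|.
Definition max_degree : nat := \max_(v : G) degree v.

Definition ncomponents : nat := n_comp (@adj G) (mem G).
Definition connected : Prop := ncomponents = 1.

(* A dart is an edge with a direction, represented by its two end vertices. *)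
Definition dart : pred (G * G) := [pred d | adj d.1 d.2].

Definition edges : {set {set G}} :=
  [set [set d.1; d.2] | d in dart].

(* The dart that follows [d] on the boundary walk of the face beside [d]. *)
Definition face_next (d : G * G) : G * G := (d.2, rot d.2 d.1).

(* An isolated vertex has no dart but contributes one (trivial) walk. *)
Definition nboundary_walks : nat :=
  fcard face_next dart + #|[set v : G | degree v == 0]|.

(* Euler's formula. A drawing with [F] faces and [C] components satisfies
   V - E + F = 1 + C and has F + C - 1 boundary walks, since a face incident
   with [j] components has [j] boundary walks. *)
Definition plane : Prop :=
  #|G| + nboundary_walks = #|edges| + 2 * ncomponents.

(* [p] lists the [k] consecutive vertices of a path that lies on a boundary
   walk, in the direction of the walk; reading the path backwards is immaterial
   for colorings. *)
Definition facial_path (k : nat) (p : seq G) : Prop :=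
  uniq p /\ exists2 d, dart d & p = map fst (traject face_next d k).

Definition rainbow (c : G -> nat) (p : seq G) : bool := uniq (map c p).
Definition monochromatic (c : G -> nat) (p : seq G) : bool :=
  constant (map c p).

Definition facial_WORM_coloring (k l : nat) (c : G -> nat) : Prop :=
  (forall p, facial_path k p -> ~~ rainbow c p) /\
  (forall p, facial_path l p -> ~~ monochromatic c p).

End Graph.

(* Main.v *)
Require Import Defs.
From mathcomp Require Import all_boot all_fingroup.

(** In a facial (P_3,P_3)-WORM coloring every 4-face uses exactly two colors,
    each of them twice. The 10-vertex graph [core] below violates this: its
    4-faces 2738 and 2537 force c 5 = c 8, then 3598 forces c 3 = c 9 <> c 5,
    so by 1489 exactly one of 1 and 4 has the color of 5 and 8. If it is 4,
    then 2846 forces c 2 = c 6 while 1526 forces c 2 <> c 6; if it is 1, the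
    two faces exchange roles. Larger graphs arise by lengthening a pendant path
    at its end: no facial 3-path has a leaf in its middle, so every facial
    3-path survives and the obstruction persists. *)

Set Implicit Arguments.
Unset Strict Implicit.
Unset Printing Implicit Defensive.

(** * Orbits listed as explicit cycles *)

Lemma porbit_fcycle (T : finType) (s : {perm T}) (c : seq T) x :
  fcycle s c -> x \in c -> porbit s x = [set y in c].
Proof.
move=> sc xc; apply/setP=> y; rewrite inE -(fconnect_cycle sc xc).
apply/porbitP/idP => [[i ->]|]; first by rewrite permX fconnect_iter.
by move/iter_findex => <-; exists (findex s x y); rewrite permX.
Qed.

(** Each cycle in [F] is a whole orbit, so sending it to the root of its head matches cycles with
    orbits; disjointness makes this injective. [x0] only serves as a default for [head]. *)
Lemma fcard_fcycles (T : finType) (f : T -> T) (a : {pred T})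
    (x0 : T) (F : seq (seq T)) :
  injective f -> all (fcycle f) F -> [::] \notin F -> uniq (flatten F) ->
  a =i flatten F -> fcard f a = size F.
Proof.
move=> injf cF nF uF aF; have sf := fconnect_sym injf.
pose r p := froot f (head x0 p).
have headF p : p \in F -> head x0 p \in p.
  by case: p => [/(negP nF)|x p _] //; rewrite mem_head.
have rF p x : p \in F -> x \in p -> froot f x = r p.
  move=> pF xp; apply/(rootP sf); rewrite (fconnect_cycle _ xp) ?headF //.
  exact: (allP cF).
have mem_r p : p \in F -> r p \in p.
  move=> pF; rewrite -(fconnect_cycle (allP cF _ pF) (headF _ pF)).
  exact: connect_root.
transitivity (size (map r F)); last by rewrite size_map.
rewrite /n_comp_mem; have /card_uniqP <- : uniq (map r F).
  elim: F {cF nF aF headF rF} uF mem_r => //= p F IH.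
  rewrite cat_uniq => /and3P[_ /hasPn dpF uF] mem_r.
  rewrite IH ?andbT //; last by move=> q qF; rewrite mem_r // inE qF orbT.
  apply/mapP=> -[q qF rpq].
  have /dpF/negP[] : r p \in flatten F.
    by apply/flattenP; exists q; rewrite // rpq mem_r // inE qF orbT.
  by rewrite mem_r ?mem_head.
apply: eq_card => x; rewrite inE /=; apply/andP/mapP.
  case=> /eqP rx; rewrite aF => /flattenP[p pF xp].
  by exists p; rewrite // -(rF p x).
case=> p pF ->; split; last first.
  by rewrite aF; apply/flattenP; exists p; rewrite ?mem_r.
exact: (roots_root sf).
Qed.

(** * Darts, face walks and edges of an embedded graph *)

Section EmbeddedGraph.
Variable G : embedded_graph.

(** Both vertices lie in one orbit of [rot v], and an orbit that meets the neighbourhood of [v] is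
    that neighbourhood. *)
Lemma adj_rot (v u : G) : adj v (Defs.rot v u) = adj v u.
Proof.
have mem_rot : Defs.rot v u \in porbit (Defs.rot v) u.
  by have := mem_porbit (Defs.rot v) 1 u; rewrite expg1.
apply/idP/idP => /rot_cyclic/setP uE.
  by move: (uE u); rewrite [RHS]inE porbit_sym mem_rot => <-.
by move: (uE (Defs.rot v u)); rewrite [RHS]inE mem_rot.
Qed.

Lemma face_next_inj : injective (@face_next G).
Proof. by move=> [x y] [z t] [-> /perm_inj->]. Qed.

Lemma face_next_dart (d : G * G) : dart (face_next d) = dart d.
Proof. by case: d => x y; rewrite /dart /= adj_rot adj_sym. Qed.

Lemma facial_path3P (q : seq G) :
  facial_path 3 q <->
  exists x y, [/\ adj x y, q = [:: x; y; Defs.rot y x] & uniq q].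
Proof.
split=> [[uq [[x y] xy qE]]|[x [y [xy qE uq]]]]; first by exists x, y.
by split=> //; exists (x, y).
Qed.

Lemma connected_to (r : G) :
  (forall x : G, connect (@adj G) x r) -> connected G.
Proof.
move=> cr; have sG : connect_sym (@adj G) := sym_connect_sym (@adj_sym G).
rewrite /connected /ncomponents -(n_comp_connect sG r).
by apply: eq_n_comp_r => x; rewrite !inE sG cr.
Qed.

(** The fibre over an edge consists of its two orientations, which differ because there are no
    loops. *)
Lemma card_dart : #|@dart G| = 2 * #|edges G|.
Proof.
rewrite -[LHS]sum1_card.
rewrite (partition_big_imset (fun d : G * G => [set d.1; d.2])) /= mulnC.
rewrite -sum_nat_const; apply: eq_bigr => _ /imsetP[[x y] xy ->].
have {}xy : adj x y := xy.
have nxy : x != y by apply: contraTneq xy => ->; rewrite adj_irr.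
rewrite sum1_card (_ : 2 = #|[set (x, y); (y, x)]|); last first.
  by rewrite cards2 xpair_eqE (negPf nxy).
apply: eq_card => -[z t]; rewrite !inE /= !xpair_eqE.
apply/andP/orP => [[zt /eqP/setP e]|].
  have {}zt : adj z t := zt.
  have nzt : z != t by apply: contraTneq zt => ->; rewrite adj_irr.
  move: (e z) (e t) nzt; rewrite !inE !eqxx orbT /=.
  by move=> /esym/orP[]/eqP-> /esym/orP[]/eqP->; rewrite !eqxx //=; auto.
by case=> /andP[/eqP-> /eqP->]; split; rewrite // 1?setUC // inE /= adj_sym.
Qed.

End EmbeddedGraph.

(** * Extending a permutation by a fixed point *)

Section OptionPerm.
Variables (T : finType) (s : {perm T}).

Lemma omap_perm_inj : injective (omap s).
Proof. by move=> [x|] [y|] // [/perm_inj->]. Qed.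

Definition option_perm : {perm option T} := perm omap_perm_inj.

Lemma porbit_option_perm x : porbit option_perm (Some x) = Some @: porbit s x.
Proof.
have iterE i : (option_perm ^+ i)%g (Some x) = Some ((s ^+ i)%g x).
  by rewrite !permX; elim: i => //= i ->; rewrite permE.
apply/setP=> y; apply/porbitP/imsetP => [[i ->]|[_ /porbitP[i ->] ->]].
  by exists ((s ^+ i)%g x); rewrite ?mem_porbit.
by exists i.
Qed.

End OptionPerm.

(** * Lengthening a pendant path at its leaf *)

Section AddLeaf.
Variables (G : embedded_graph) (l p : G).
Hypothesis adj_l : forall v, adj l v = (v == p).

Definition leaf_adj (x y : option G) : bool :=
  match x, y with
  | Some v, Some w => adj v w
  | Some v, None | None, Some v => v == l
  | None, None => false
  end.

(** The new vertex [None] hangs on the old leaf [l]. Now [l] has the two neighbours [p] and [None],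
    whose only cyclic order is a transposition; at all other old vertices the order is kept. *)
Definition leaf_rot (x : option G) : {perm option G} :=
  if x is Some v then
    if v == l then tperm (Some p) None else option_perm (Defs.rot v)
  else 1%g.

Lemma leaf_adj_sym : symmetric leaf_adj.
Proof. by move=> [v|] [w|] //=; apply: adj_sym. Qed.

Lemma leaf_adj_irr : irreflexive leaf_adj.
Proof. by case=> //= v; apply: adj_irr. Qed.

Lemma leaf_rot_cyclic x y :
  leaf_adj x y -> porbit (leaf_rot x) y = [set z | leaf_adj x z].
Proof.
case: x => [v|] /=; last first.
  case: y => // _ /eqP->; rewrite (@porbit_fcycle _ _ [:: Some l]) ?mem_head //.
    by apply/setP=> -[w|]; rewrite !inE.
  by rewrite /= perm1 eqxx.
have [->|/negPf vl] := eqVneq v l.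
  move=> ly; rewrite (@porbit_fcycle _ _ [:: Some p; None]).
  - by apply/setP=> -[w|]; rewrite !inE ?adj_l ?orbF ?eqxx.
  - by rewrite /= tpermL tpermR !eqxx.
  - by case: y ly => [y|] //=; rewrite adj_l !inE => /eqP->; rewrite eqxx.
case: y => [y|]; rewrite ?vl // => vy; rewrite porbit_option_perm rot_cyclic //.
apply/setP=> -[w|]; rewrite inE ?vl.
  by rewrite mem_imset ?inE // => ? ? [].
by apply/negP=> /imsetP[].
Qed.

Definition add_leaf : embedded_graph :=
  EmbeddedGraph leaf_adj_sym leaf_adj_irr leaf_rot_cyclic.

Let l_rot : Defs.rot l p = p.
Proof. by apply/eqP; rewrite -adj_l adj_rot adj_l. Qed.

(** A face walk turns at the head of the dart, and among old vertices only [l] has a new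
    rotation. *)
Lemma face_next_add_leaf (d : G * G) : d.2 != l ->
  @face_next add_leaf (Some d.1, Some d.2) =
  (Some (face_next d).1, Some (face_next d).2).
Proof. by case: d => x y /= /negPf yl; rewrite /face_next /= yl permE. Qed.

Lemma degree_add_leaf (v : G) :
  @degree add_leaf (Some v) = (v == l) + degree v.
Proof.
rewrite /degree (cardsD1 None) !inE /=; congr (_ + _).
rewrite -[RHS](card_imset _ (@Some_inj _)); apply: eq_card => -[w|].
  by rewrite mem_imset ?inE // => ? ? [].
by rewrite !inE; apply/esym/negP=> /imsetP[].
Qed.

Lemma degree_new_leaf : @degree add_leaf None = 1.
Proof.
by rewrite -(cards1 (Some l)); apply: eq_card => -[w|]; rewrite !inE.
Qed.

Lemma degree_l : degree l = 1.
Proof. by rewrite -(cards1 p); apply: eq_card => w; rewrite !inE adj_l. Qed.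

(** The stretch p, l, p of a face walk becomes p, l, [None], l, p and nothing else changes, so the
    face orbits correspond under [h] and [g]. *)
Lemma nfaces_add_leaf :
  fcard (@face_next add_leaf) (@dart add_leaf) = fcard (@face_next G) (@dart G).
Proof.
pose h (d : G * G) : add_leaf * add_leaf := (Some d.1, Some d.2).
(* The two new darts immediately precede [(l, p)] on their walk, hence are sent to it. *)
pose g (d : add_leaf * add_leaf) : G * G :=
  if d is (Some x, Some y) then (x, y) else (l, p).
have closed_dart : closed (frel (@face_next add_leaf)) (@dart add_leaf).
  by move=> d e /eqP <-; apply/esym/(@face_next_dart add_leaf).
have symG := fconnect_sym (@face_next_inj G).
have symA := fconnect_sym (@face_next_inj add_leaf).
have step1 : @face_next add_leaf (Some p, Some l) = (Some l, None).
  by rewrite /face_next /= eqxx tpermL.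
have step2 : @face_next add_leaf (Some l, None) = (None, Some l).
  by rewrite /face_next /= perm1.
have step3 : @face_next add_leaf (None, Some l) = (Some l, Some p).
  by rewrite /face_next /= eqxx tpermR.
have stepG : @face_next G (p, l) = (l, p) by rewrite /face_next /= l_rot.
have dl x : adj x l = (x == p) by rewrite adj_sym adj_l.
rewrite (adjunction_n_comp h symA symG closed_dart) //.
apply: (@intro_adjunction _ _ h _ _ symG _ closed_dart (fun d _ => g d)).
  move=> [[x|] [y|]] d_dart; split=> //=.
  - move=> e _ /eqP<-; have [yl|yl] := eqVneq y l.
      have xp : x = p by apply/eqP; rewrite -dl -yl.
      by rewrite yl xp step1 /= -stepG fconnect1.
    by rewrite (face_next_add_leaf (d := (x, y)) yl) fconnect1.
  - have -> : x = l by apply/eqP.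
    rewrite (_ : h _ = iter 2 (@face_next add_leaf) (Some l, None)).
      exact: fconnect_iter.
    by rewrite /= step2 step3.
  - have -> : x = l by apply/eqP.
    by move=> e _ /eqP<-; rewrite step2 connect0.
  - have -> : y = l by apply/eqP.
    by rewrite (_ : h _ = face_next (None : add_leaf, Some l)) ?fconnect1 //
      step3.
  - have -> : y = l by apply/eqP.
    by move=> e _ /eqP<-; rewrite step3 connect0.
move=> [x y] xy; split=> [|d /eqP<-]; first exact: connect0.
have [yl|yl] := eqVneq y l; last first.
  have := face_next_add_leaf (d := (x, y)) yl; rewrite /h /= => <-.
  exact: fconnect1.
have -> : x = p by apply/eqP; rewrite -dl -yl.
rewrite yl stepG (_ : h (l, p) = iter 3 (@face_next add_leaf) (h (p, l))).
  exact: fconnect_iter.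
by rewrite /= step1 step2 step3.
Qed.

(** The inclusion [Some] and the contraction of [None] onto [l] match the components. *)
Lemma ncomponents_add_leaf : ncomponents add_leaf = ncomponents G.
Proof.
have symG := sym_connect_sym (@adj_sym G).
have symA := sym_connect_sym (@adj_sym add_leaf).
have closedA : closed (@adj add_leaf) (mem add_leaf) by [].
rewrite /ncomponents (adjunction_n_comp Some symA symG closedA) //.
apply: (@intro_adjunction _ _ Some _ _ symG _ closedA (fun x _ => odflt l x)).
  move=> [x|] _; split=> //=; [|by apply: connect1; rewrite /= eqxx|].
    move=> [y|] _ /=; first exact: connect1.
    by move/eqP->; apply: connect0.
  by move=> [y|] _ //= /eqP->; apply: connect0.
move=> x _; split=> [|y xy]; first exact: connect0.
exact: connect1.
Qed.

Lemma card_edges_add_leaf : #|edges add_leaf| = #|edges G|.+1.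
Proof.
pose lift (e : {set G}) : {set add_leaf} := Some @: e.
have liftE x y : lift [set x; y] = [set Some x; Some y].
  by rewrite /lift imsetU !imset_set1.
have edgesE : edges add_leaf = [set Some l; None] |: (lift @: edges G).
  apply/setP=> e; rewrite in_setU1; apply/imsetP/orP.
    case=> -[[x|] [y|]] d_dart -> /=.
    - right; apply/imsetP; exists [set x; y]; rewrite ?liftE //.
      by apply/imsetP; exists (x, y).
    - by move: d_dart; rewrite inE /= => /eqP->; left.
    - by move: d_dart; rewrite inE /= => /eqP->; left; rewrite setUC.
    - by [].
  case=> [/eqP->|/imsetP[_ /imsetP[[x y] xy ->] ->]].
    by exists (Some l, None); rewrite ?inE /=.
  by exists (Some x, Some y); rewrite ?liftE.
rewrite edgesE cardsU1 card_imset; last exact/imset_inj/Some_inj.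
suff /negPf-> : [set Some l; None] \notin lift @: edges G by [].
apply/imsetP=> -[e _ /setP/(_ None)].
by rewrite !inE eqxx orbT => /esym/imsetP[].
Qed.

Lemma isolated_add_leaf :
  #|[set v : add_leaf | degree v == 0]| = #|[set v : G | degree v == 0]|.
Proof.
rewrite -[RHS](card_imset _ (@Some_inj _)); apply: eq_card => -[v|].
  rewrite mem_imset ?inE ?degree_add_leaf; last by move=> ? ? [].
  by have [->|//] := eqVneq v l; rewrite degree_l.
by rewrite inE degree_new_leaf; apply/esym/negP=> /imsetP[].
Qed.

(** One vertex and one edge are gained, so both sides of Euler's formula grow by one. *)
Lemma plane_add_leaf : plane G -> plane add_leaf.
Proof.
rewrite /plane /nboundary_walks nfaces_add_leaf isolated_add_leaf.
by rewrite ncomponents_add_leaf card_edges_add_leaf card_option !addSn => ->.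
Qed.

(* A facial path of G through l ends there, as l has a single neighbour. *)
Lemma facial_path3_add_leaf (q : seq G) :
  facial_path 3 q -> @facial_path add_leaf 3 (map Some q).
Proof.
case/facial_path3P=> x [y [xy -> uq]].
have yl : y != l.
  apply: contraTneq uq => yl; move: xy; rewrite adj_sym yl adj_l => /eqP->.
  by rewrite l_rot /= !inE eqxx orbT.
apply/facial_path3P; exists (Some x), (Some y).
by split; rewrite ?map_inj_uniq //= ?(negPf yl) ?permE // => ? ? [].
Qed.

Lemma facial_WORM_add_leaf (c : add_leaf -> nat) :
  facial_WORM_coloring 3 3 c -> facial_WORM_coloring 3 3 (c \o Some).
Proof.
by case=> rb mn; split=> q /facial_path3_add_leaf; [move/rb|move/mn];
  rewrite /rainbow /monochromatic -map_comp.
Qed.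

End AddLeaf.

(** * Embedded graphs from cyclic neighbour lists *)

Section NeighbourLists.
Variables (T : finType) (nb : T -> seq T).
Hypotheses (nb_uniq : forall v, uniq (nb v))
  (nb_sym : forall v w, (w \in nb v) = (v \in nb w))
  (nb_irr : forall v, v \notin nb v).

Definition list_rot v : {perm T} := perm (can_inj (prev_next (nb_uniq v))).

Lemma list_rot_cyclic v u :
  u \in nb v -> porbit (list_rot v) u = [set w | w \in nb v].
Proof.
apply: porbit_fcycle; rewrite (eq_cycle (e' := frel (next (nb v)))).
  exact: cycle_next.
by move=> x y; rewrite /= permE.
Qed.

Definition graph_of_lists : embedded_graph :=
  @EmbeddedGraph T (fun v w => w \in nb v) nb_sym (fun v => negbTE (nb_irr v))
    list_rot list_rot_cyclic.

Lemma degree_of_lists (v : graph_of_lists) : degree v = size (nb v).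
Proof. by rewrite /degree cardsE; apply/card_uniqP. Qed.

End NeighbourLists.

(** * Color patterns on facial 3-paths and 4-faces *)

Lemma facial_WORM3_triple (G : embedded_graph) (c : G -> nat) (x y z : G) :
  facial_WORM_coloring 3 3 c -> adj x y -> Defs.rot y x = z ->
  uniq [:: x; y; z] ->
  [\/ c x = c y /\ c x <> c z, c x = c z /\ c x <> c y |
      c y = c z /\ c x <> c y].
Proof.
case=> rb mn xy yz uq; have F : facial_path 3 [:: x; y; z].
  by apply/facial_path3P; exists x, y; rewrite yz.
move: (rb _ F) (mn _ F); rewrite /rainbow /monochromatic /= !inE !andbT.
rewrite (eq_sym (c y) (c x)) (eq_sym (c z) (c x)).
case: (c x =P c y) (c x =P c z) (c y =P c z) => [?|?] [?|?] [?|?] //= _ _;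
  first [by constructor 1 | by constructor 2 | by constructor 3 | congruence].
Qed.

(** Any three vertices of a 4-face form a facial path. Three or more colors would make some such
    path rainbow, and a color used three times would make one monochromatic; what remains is a split
    into two pairs. *)
Lemma facial_WORM3_quad (G : embedded_graph) (c : G -> nat) (x y z t : G) :
  facial_WORM_coloring 3 3 c -> uniq [:: x; y; z; t] -> adj x y ->
  Defs.rot y x = z -> Defs.rot z y = t -> Defs.rot t z = x ->
  Defs.rot x t = y ->
  [\/ [/\ c x = c y, c z = c t & c x <> c z],
      [/\ c x = c z, c y = c t & c x <> c y] |
      [/\ c x = c t, c y = c z & c x <> c y]].
Proof.
move=> W uq xy yz zt tx xt.
have next_adj (a b d : G) : adj a b -> Defs.rot b a = d -> adj b d.
  by move=> ab <-; rewrite adj_rot adj_sym.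
have ayz := next_adj _ _ _ xy yz; have azt := next_adj _ _ _ ayz zt.
have atx := next_adj _ _ _ azt tx.
(* Three cyclically consecutive vertices begin some rotation of the list, hence are distinct. *)
have rot_uniq k : uniq (seq.rot k [:: x; y; z; t]) by rewrite rot_uniq.
move: (facial_WORM3_triple W xy yz (take_uniq 3 (rot_uniq 0)))
  (facial_WORM3_triple W ayz zt (take_uniq 3 (rot_uniq 1)))
  (facial_WORM3_triple W azt tx (take_uniq 3 (rot_uniq 2)))
  (facial_WORM3_triple W atx xt (take_uniq 3 (rot_uniq 3))).
(* Each of the 81 combinations of triple patterns yields one of the pairings or is contradictory. *)
by do 4![case=> -[? ?]]; first [by constructor 1; split; congruence
  | by constructor 2; split; congruence | by constructor 3; split; congruence
  | congruence].
Qed.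

(** * The core graph on ten vertices *)

Definition V (i : nat) : 'I_10 := Ordinal (ltn_pmod i (isT : 0 < 10)).

(** Turns a claim about all vertices into a check over an explicit list, which can be evaluated. *)
Lemma forall_V (P : pred 'I_10) :
  all P [seq V i | i <- iota 0 10] -> forall v, P v.
Proof.
move=> /allP allP v; apply: allP; apply/mapP; exists (val v).
  by rewrite mem_iota /= ltn_ord.
by apply/val_inj; rewrite /= modn_small.
Qed.

(* Clockwise neighbour lists; the leaf 0 hangs in the face bounded by the
   triangle 159. *)
Definition core_nb (v : 'I_10) : seq 'I_10 := map V (nth [::] [::
  [:: 9]; [:: 5; 9; 4; 6]; [:: 7; 5; 6; 8]; [:: 7; 8; 5]; [:: 6; 1; 8];
  [:: 9; 1; 2; 3]; [:: 4; 2; 1]; [:: 2; 3]; [:: 3; 2; 4; 9];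
  [:: 1; 0; 5; 8]] v).

Lemma core_nb_uniq v : uniq (core_nb v).
Proof. by move: v; apply: forall_V; vm_compute. Qed.

Lemma core_nb_sym v w : (w \in core_nb v) = (v \in core_nb w).
Proof.
apply/eqP; move: w; apply: forall_V; move: v; apply: forall_V.
by vm_compute.
Qed.

Lemma core_nb_irr v : v \notin core_nb v.
Proof. by move: v; apply: forall_V; vm_compute. Qed.

Definition core : embedded_graph :=
  graph_of_lists core_nb_uniq core_nb_sym core_nb_irr.

(** Each face is listed by its boundary vertices; zipping with the rotated list gives its darts. The
    first walk has length five: it goes round the triangle 159 and along the leaf edge in both
    directions. *)
Definition core_faces : seq (seq (core * core)) :=
  [seq [seq (V d.1, V d.2) | d <- zip f (rot 1 f)] | f <- [::
    [:: 0; 9; 5; 1; 9]; [:: 1; 5; 2; 6]; [:: 1; 4; 8; 9]; [:: 1; 6; 4];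
    [:: 2; 7; 3; 8]; [:: 2; 5; 3; 7]; [:: 2; 8; 4; 6]; [:: 3; 5; 9; 8]]].

(** Expresses the face walk by [next] on lists, which evaluates where the permutation [rot] does
    not. *)
Lemma core_face_next (d : core * core) :
  face_next d = (d.2, next (core_nb d.2) d.1).
Proof. by rewrite /face_next /= permE. Qed.

Lemma core_dart : @dart core =i flatten core_faces.
Proof.
move=> [v w]; apply/eqP; move: w; apply: forall_V; move: v; apply: forall_V.
by vm_compute.
Qed.

Lemma plane_connected_core : plane core /\ connected core.
Proof.
have cC : connected core.
  (* [route v] lists the vertices after [v] on a walk from [v] to 9. *)
  pose route v : seq core := map V (nth [::] [:: [:: 9]; [:: 9]; [:: 8; 9];
    [:: 8; 9]; [:: 8; 9]; [:: 9]; [:: 4; 8; 9]; [:: 3; 8; 9]; [:: 9]; [::]] v).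
  apply: (@connected_to core (V 9)) => v; apply/connectP; exists (route v).
    by move: v; apply: forall_V; vm_compute.
  by apply/eqP; move: v; apply: forall_V; vm_compute.
have size_core : size (flatten core_faces) = 32 by vm_compute.
have uniq_core : uniq (flatten core_faces) by vm_compute.
have dartE : #|@dart core| = 32.
  by rewrite (eq_card core_dart) -size_core; apply/card_uniqP.
split=> //; rewrite /plane /nboundary_walks cC card_ord.
have -> : [set v : core | degree v == 0] = set0.
  apply/setP=> v; rewrite !inE degree_of_lists; apply/negbTE.
  by move: v; apply: forall_V; vm_compute.
rewrite (@fcard_fcycles _ _ _ (V 0, V 0) core_faces) //.
(* Euler's formula reads 10 + 8 = 16 + 2, the 16 edges being half of the 32 darts. *)
- suff -> : #|edges core| = 16 by rewrite cards0.
  by apply/eqP; rewrite -(eqn_pmul2l (isT : 0 < 2)) -card_dart dartE.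
- exact: (@face_next_inj core).
- pose next_dart (d : core * core) := (d.2, next (core_nb d.2) d.1).
  apply/allP=> f fF; rewrite (eq_cycle (e' := frel next_dart)).
    by move: f fF; apply/allP; vm_compute.
  by move=> d e; rewrite /= core_face_next.
- exact: core_dart.
Qed.

Lemma degree_core (v : core) : 0 < degree v <= 4.
Proof. by rewrite degree_of_lists; move: v; apply: forall_V; vm_compute. Qed.

Lemma no_WORM_core (c : core -> nat) : ~ facial_WORM_coloring 3 3 c.
Proof.
move=> W.
have quad i j k m : uniq [:: V i; V j; V k; V m] -> V j \in core_nb (V i) ->
    next (core_nb (V j)) (V i) = V k -> next (core_nb (V k)) (V j) = V m ->
    next (core_nb (V m)) (V k) = V i -> next (core_nb (V i)) (V m) = V j ->
  [\/ [/\ c (V i) = c (V j), c (V k) = c (V m) & c (V i) <> c (V k)],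
      [/\ c (V i) = c (V k), c (V j) = c (V m) & c (V i) <> c (V j)] |
      [/\ c (V i) = c (V m), c (V j) = c (V k) & c (V i) <> c (V j)]].
  move=> uq ij jk km mi im; apply: (facial_WORM3_quad W uq ij);
    by rewrite /= permE.
(* The 4-faces come in the order of the deduction, so that contradictory branches close early. *)
move: (quad 2 7 3 8 isT isT erefl erefl erefl erefl)
  (quad 2 5 3 7 isT isT erefl erefl erefl erefl)
  (quad 3 5 9 8 isT isT erefl erefl erefl erefl)
  (quad 1 4 8 9 isT isT erefl erefl erefl erefl)
  (quad 2 8 4 6 isT isT erefl erefl erefl erefl)
  (quad 1 5 2 6 isT isT erefl erefl erefl erefl).
move: (c (V 1)) (c (V 2)) (c (V 3)) (c (V 4)) (c (V 5)) (c (V 6)) (c (V 7))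
  (c (V 8)) (c (V 9)) => c1 c2 c3 c4 c5 c6 c7 c8 c9.
by do 6![case=> -[? ? ?] //; try congruence].
Qed.

(** * Induction on the number of vertices, starting from the core *)

Theorem theorem3 :
  forall n : nat, 18 <= n ->
  exists G : embedded_graph,
    [/\ plane G, connected G, #|G| = n & max_degree G = 4] /\
    ~ (exists c : G -> nat, facial_WORM_coloring 3 3 c).
Proof.
move=> n n_ge18; have le_n : 10 <= n by apply: leq_trans n_ge18.
(* The induction also carries a leaf [l] with its neighbour [p], where the next vertex is attached.
   The old leaf then has degree 2, so the maximum degree stays 4. *)
suff [G [l] [p] [[pG cG cardG] degG [v v4] adj_l noW]] :
    exists (G : embedded_graph) (l p : G),
    [/\ [/\ plane G, connected G & #|G| = n],
        forall v : G, 0 < degree v <= 4, exists v : G, degree v = 4,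
        forall w, adj l w = (w == p)
      & forall c : G -> nat, ~ facial_WORM_coloring 3 3 c].
  exists G; split; last by case=> c; apply: noW.
  split=> //; apply/eqP; rewrite eqn_leq; apply/andP; split.
    by apply/bigmax_leqP => w _; case/andP: (degG w).
  by rewrite -v4; apply: leq_bigmax.
rewrite -(subnKC le_n); elim: (n - 10) => [|k].
  have [pC cC] := plane_connected_core.
  exists core, (V 0), (V 9); split.
  - by split; rewrite // card_ord.
  - exact: degree_core.
  - by exists (V 1); rewrite degree_of_lists.
  - by move=> w; rewrite [LHS]inE.
  - exact: no_WORM_core.
case=> G [l] [p] [[pG cG cardG] degG [v v4] adj_l noW].
exists (add_leaf adj_l), None, (Some l); split.
- split; first exact: plane_add_leaf.
    by rewrite /connected ncomponents_add_leaf.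
  by rewrite card_option cardG addnS.
- move=> [w|]; last by rewrite degree_new_leaf.
  rewrite degree_add_leaf; have [->|_] := eqVneq w l; last exact: degG.
  by rewrite (degree_l adj_l).
- exists (Some v); rewrite degree_add_leaf v4; have [vl|//] := eqVneq v l.
  by move: v4; rewrite vl (degree_l adj_l).
- by move=> [w|].
- by move=> c /facial_WORM_add_leaf; apply: noW.
Qed.
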